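(* Let $n\ge2$ and let $G$ be a proper convex subdomain of $\mathbb{R}^n$. For all $x,y\in G$, $$v_G(x,y)\le c\,k_G(x,y),\qquad c=\frac{\pi}{\log 4}.$$
   Context: For a domain $G\subsetneq\mathbb{R}^n$ whose boundary $\partial G$ is not a proper subset of a line, the visual angle metric is $v_G(x,y)=\sup_{z\in\partial G}\measuredangle(x,z,y)$ for $x,y\in G$, where $\measuredangle(x,z,y)\in[0,\pi]$ is the angle at $z$ between the segments $[x,z]$ and $[y,z]$ (so $v_G(x,x)=0$). The quasihyperbolic metric of a proper subdomain $G\subset\mathbb{R}^n$ is $$k_G(x,y)=\inf_\gamma\int_\gamma\frac{1}{d(z,\partial G)}\,|dz|,\quad x,y\in G,$$ where the infimum is over all rectifiable arcs $\gamma$ joining $x$ to $y$ in $G$ and $d(z,\partial G)$ is the Euclidean distance from $z$ to $\partial G$. Here $\log$ is the natural logarithm. *)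

(* Defs.v *)
From HB Require Import structures.
From mathcomp Require Import all_boot all_order all_algebra.
From mathcomp Require Import all_classical all_reals all_analysis.
Import Order.TTheory GRing.Theory Num.Theory.
Import numFieldNormedType.Exports.

Set Implicit Arguments.
Unset Strict Implicit.
Unset Printing Implicit Defensive.

Local Open Scope classical_set_scope.
Local Open Scope ring_scope.

(* Points of R^n are row vectors.  The norm `|x| that MathComp-Analysis puts on
   'rV[R]_n is the sup norm: it is used only through the topology it induces,
   and all lengths, distances and angles go through [enorm] and [edot]. *)

Section Euclidean.
Context {R : realType} {n : nat}.
Implicit Types (u v x y z : 'rV[R]_n) (G : set 'rV[R]_n).

Definition edot u v : R := \sum_(i < n) u 0 i * v 0 i.

Definition enorm u : R := Num.sqrt (edot u u).

Definition is_domain G := [/\ open G, G !=set0 & connected G].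

Definition boundary G : set 'rV[R]_n := closure G `\` interior G.

(* Significant only for x <> z and y <> z, which always holds below: there z is
   a boundary point of an open set containing x and y. *)
Definition angle x z y : R :=
  acos (edot (x - z) (y - z) / (enorm (x - z) * enorm (y - z))).

Definition visual_angle G x y : \bar R :=
  ereal_sup [set (angle x z y)%:E | z in boundary G].

Definition boundary_dist G z : R := inf [set enorm (z - w) | w in boundary G].

End Euclidean.

Section LineIntegral.
Context {R : realType} {n : nat}.
Implicit Types (a b t u : R) (x y : 'rV[R]_n) (G : set 'rV[R]_n).
Implicit Types (f : 'rV[R]_n -> R) (g : R -> 'rV[R]_n).

(* Length of the polygon inscribed in g at the nodes a :: s; same indexing as
   [variation], which is restricted to real-valued functions. *)
Definition polygon_length a b g (s : seq R) : R :=
  let F := g \o nth b (a :: s) in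
  \sum_(0 <= i < size s) enorm (F i.+1 - F i).

Definition curve_length a b g : \bar R :=
  ereal_sup [set (polygon_length a b g s)%:E | s in itv_partition a b].

(* An arc is an injective curve; a = b is allowed, so that the single point x
   is an arc joining x to x. *)
Definition rectifiable_arc G x y a b g :=
  [/\ a <= b,
      {within `[a, b], continuous g},
      {in `[a, b] &, injective g},
      (curve_length a b g < +oo)%E &
      [/\ g a = x, g b = y & g @` `[a, b] `<=` G]].

(* The parametrization of g by arc length, on [0, length of g].  For a
   continuous rectifiable g, the length of g on [a, t] is continuous and
   nondecreasing in t, so the infimum is a parameter where it equals u. *)
Definition arc_length_param a b g u : 'rV[R]_n :=
  g (inf [set t | t \in `[a, b] /\ (u%:E <= curve_length a t g)%E]).

Definition line_integral f a b g : \bar R :=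
  (\int[@lebesgue_measure R]_(u in `[0%R, fine (curve_length a b g)])
     (f (arc_length_param a b g u))%:E)%E.

Definition quasihyperbolic G x y : \bar R :=
  ereal_inf [set I | exists a b g, rectifiable_arc G x y a b g /\
    I = line_integral (fun z => (boundary_dist G z)^-1) a b g].

End LineIntegral.

(* Main.v *)
Require Import Defs.
From mathcomp Require Import all_boot all_order all_algebra.
From mathcomp Require Import all_classical all_reals all_analysis.
From mathcomp Require Import measurable_realfun.
From mathcomp Require Import ring lra.
Import Order.TTheory GRing.Theory Num.Theory.
Import numFieldNormedType.Exports.

Set Implicit Arguments.
Unset Strict Implicit.
Unset Printing Implicit Defensive.

Local Open Scope classical_set_scope.
Local Open Scope ring_scope.

(** The sharper inequality [visual_angle G x y <= quasihyperbolic G x y] holds,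
    and the theorem follows because [pi / ln 4 >= 1].

    Fix a boundary point z and an arc from x to y in G, parametrized by arc
    length as c : [0, L] -> G.  Seen from z, a point moving at unit speed at
    distance h from z turns at rate at most 1 / h, and h is at least the
    distance from the point to the boundary.  So the angle swept between x and
    y is at most the quasihyperbolic length of the arc.

    The angle is not differentiable along the arc in general, so the argument
    is run on a fine uniform subdivision.  Three facts carry it.

    - If A and A' are the angles at z from x to p and from x to p', the
      Cauchy-Schwarz inequality for the components of p - z and p' - z
      orthogonal to x - z bounds |p - p'| below by the distance between two
      points of a plane with the same radii and polar angles A and A'
      ([edot_le_cos_angleB]).  In particular
      4 |p - z| |p' - z| sin^2((A' - A) / 2) <= |p - p'|^2
      ([sqr_sin_half_angleB]), so that on a short step the angle grows by at
      most the length of the step over the distance to z, up to a relative error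
      of the order of eta when the step is at most eta times that distance
      ([angleB_le_edist]).

    - Along c, both the point and its distance to the boundary are 1-Lipschitz
      ([arc_length_param_lipschitz], [boundary_dist_lipschitz]).  Hence on such
      a step the integrand 1 / d varies by a factor close to 1, and the integral
      over the step dominates (1 - 3 eta) times the increase of the angle.

    - The distance to the boundary has a positive minimum along c, so for every
      eta a uniform subdivision into steps of this kind exists.  Adding up the
      steps and letting eta tend to 0 gives [angle_le_integral]. *)

(** * The Euclidean norm of row vectors *)

Section EuclideanNorm.
Context {R : realType} {n : nat}.
Implicit Types (u v w x y z : 'rV[R]_n).

Lemma edotC u v : edot u v = edot v u.
Proof. by apply: eq_bigr => i _; rewrite mulrC. Qed.

Lemma edotDl u v w : edot (u + v) w = edot u w + edot v w.
Proof. by rewrite -big_split; apply: eq_bigr => i _; rewrite mxE mulrDl. Qed.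

Lemma edotZl (a : R) u v : edot (a *: u) v = a * edot u v.
Proof. by rewrite /edot mulr_sumr; apply: eq_bigr => i _; rewrite mxE mulrA. Qed.

Lemma edotNl u v : edot (- u) v = - edot u v.
Proof. by rewrite -scaleN1r edotZl mulN1r. Qed.

Lemma edotDr u v w : edot w (u + v) = edot w u + edot w v.
Proof. by rewrite edotC edotDl !(edotC w). Qed.

Lemma edotZr (a : R) u v : edot v (a *: u) = a * edot v u.
Proof. by rewrite edotC edotZl edotC. Qed.

Lemma edotNr u v : edot v (- u) = - edot v u.
Proof. by rewrite edotC edotNl edotC. Qed.

Definition edotE := (edotDl, edotDr, edotZl, edotZr, edotNl, edotNr).

Lemma edot_ge0 u : 0 <= edot u u.
Proof. by apply: sumr_ge0 => i _; rewrite -expr2 sqr_ge0. Qed.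

Lemma edot_eq0 u : edot u u = 0 -> u = 0.
Proof.
move=> u0; apply/rowP => i; rewrite mxE; apply/eqP.
rewrite -sqrf_eq0 expr2.
have h : \sum_(j < n) u 0 j * u 0 j == 0 by apply/eqP.
move: h; rewrite psumr_eq0 => [/allP/(_ i)|j _]; last by rewrite -expr2 sqr_ge0.
by rewrite mem_index_enum => /(_ isT) /implyP/(_ isT).
Qed.

Lemma enorm_ge0 u : 0 <= enorm u. Proof. exact: sqrtr_ge0. Qed.

Lemma sqr_enorm u : enorm u ^+ 2 = edot u u.
Proof. by rewrite sqr_sqrtr // edot_ge0. Qed.

Lemma enorm_gt0 u : u != 0 -> 0 < enorm u.
Proof.
move=> u0; rewrite lt_def enorm_ge0 andbT; apply: contra u0 => /eqP u0.
by apply/eqP/edot_eq0; rewrite -sqr_enorm u0 expr0n.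
Qed.

Lemma enorm0 : enorm (0 : 'rV[R]_n) = 0.
Proof.
by rewrite /enorm /edot big1 ?sqrtr0 // => i _; rewrite mxE mul0r.
Qed.

Lemma enormN u : enorm (- u) = enorm u.
Proof. by rewrite /enorm !edotE opprK. Qed.

Lemma enormB u v : enorm (u - v) = enorm (v - u).
Proof. by rewrite -enormN opprB. Qed.

(** Cauchy-Schwarz inequality. *)
Lemma edot_sqr_le u v : edot u v ^+ 2 <= edot u u * edot v v.
Proof.
have [->|v0] := eqVneq v 0.
  have -> : edot u 0 = 0 by rewrite -(scale0r 0) edotZr mul0r.
  have -> : edot (0 : 'rV[R]_n) 0 = 0 by rewrite -(scale0r 0) edotZr mul0r.
  by rewrite expr0n mulr0.
have vv : 0 < edot v v by rewrite -sqr_enorm exprn_gt0 // enorm_gt0.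
(* Up to the factor [edot v v], this is the component of u orthogonal to v;
   its square is [edot v v] times the gap in the inequality. *)
have := edot_ge0 (edot v v *: u - edot u v *: v).
rewrite !edotE (edotC v u) => h.
rewrite -subr_ge0 -(pmulr_rge0 _ vv); apply: le_trans h _.
by rewrite le_eqVlt; apply/orP; left; apply/eqP; ring.
Qed.

Lemma edot_le_enorm u v : edot u v <= enorm u * enorm v.
Proof.
apply: le_trans (ler_norm _) _.
rewrite -(@ler_pXn2r _ 2%N) ?nnegrE ?mulr_ge0 ?enorm_ge0 //.
by rewrite exprMn !sqr_enorm -normrX ger0_norm ?sqr_ge0 // edot_sqr_le.
Qed.

Lemma ler_enormD u v : enorm (u + v) <= enorm u + enorm v.
Proof.
rewrite -(@ler_pXn2r _ 2%N) ?nnegrE ?addr_ge0 ?enorm_ge0 //.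
rewrite sqr_enorm !edotE (edotC v u) sqrrD !sqr_enorm.
have := edot_le_enorm u v; lra.
Qed.

Lemma ler_edist_add w u v : enorm (u - v) <= enorm (u - w) + enorm (w - v).
Proof. by apply: le_trans (ler_enormD _ _); rewrite addrA subrK. Qed.

(** With [enorm_le_mx_norm], this makes the Euclidean and sup norms equivalent:
    topological facts, which refer to the sup norm, transfer to [enorm]. *)
Lemma mx_norm_le_enorm u : `|u| <= enorm u.
Proof.
have [->|u0] := eqVneq u 0; first by rewrite normr0 enorm_ge0.
have := u0; rewrite -normr_eq0 => /mx_norm_neq0[[i j] /= ]; rewrite ord1.
rewrite /Num.norm/= => ->.
rewrite -(@ler_pXn2r _ 2%N) ?nnegrE ?normr_ge0 ?enorm_ge0 //.
rewrite sqr_enorm -normrX ger0_norm ?sqr_ge0 // /edot (bigD1 j) //= -expr2.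
by rewrite lerDl sumr_ge0 // => k _; rewrite -expr2 sqr_ge0.
Qed.

Lemma enorm_le_mx_norm u : enorm u <= n%:R * `|u|.
Proof.
have ui i : `|u 0 i| <= `|u|.
  rewrite [leRHS]mx_normrE.
  exact: (le_bigmax _ (fun ij : 'I_1 * 'I_n => `|u ij.1 ij.2|) (0, i)).
rewrite -(@ler_pXn2r _ 2%N) ?nnegrE ?mulr_ge0 ?enorm_ge0 ?ler0n //.
rewrite sqr_enorm exprMn.
have : edot u u <= n%:R * `|u| ^+ 2.
  apply: le_trans (_ : _ <= \sum_(i < n) `|u| ^+ 2) _; last first.
    by rewrite sumr_const card_ord mulr_natl.
  apply: ler_sum => i _; rewrite -expr2 -[_ ^+ 2]ger0_norm ?sqr_ge0 // normrX.
  by rewrite ler_pXn2r ?nnegrE.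
move/le_trans; apply; rewrite ler_wpM2r ?sqr_ge0 // expr2 -natrM ler_nat.
by case: (n) => // k; rewrite mulnS leq_addr.
Qed.

End EuclideanNorm.

(** * Variation of the angle at a point *)

Section Angle.
Context {R : realType} {n : nat}.
Implicit Types (x y z : 'rV[R]_n).

Lemma cosine_bounds (u v : 'rV[R]_n) : u != 0 -> v != 0 ->
  -1 <= edot u v / (enorm u * enorm v) <= 1.
Proof.
move=> u0 v0; have uv : 0 < enorm u * enorm v by rewrite mulr_gt0 ?enorm_gt0.
rewrite ler_pdivlMr // ler_pdivrMr // mul1r edot_le_enorm andbT mulN1r lerNl.
by rewrite -edotNl (le_trans (edot_le_enorm _ _)) // enormN.
Qed.

Lemma angle_ge0 x z y : x != z -> y != z -> 0 <= angle x z y.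
Proof. by move=> xz yz; rewrite acos_ge0 // cosine_bounds // subr_eq0. Qed.

Lemma angle_le_pi x z y : x != z -> y != z -> angle x z y <= pi.
Proof. by move=> xz yz; rewrite acos_lepi // cosine_bounds // subr_eq0. Qed.

Lemma angle_xzx x z : x != z -> angle x z x = 0.
Proof.
move=> xz; rewrite /angle -expr2 sqr_enorm divff ?acos1 //.
by rewrite -sqr_enorm expf_neq0 // gt_eqF // enorm_gt0 // subr_eq0.
Qed.

(** Rotating y about the line through z and x into the half-plane bounded by this
    line that contains y' leaves both angles unchanged and can only decrease the
    angle between y and y'.  This plays the role of the triangle inequality for
    angles. *)
Lemma edot_le_cos_angleB x z y y' : x != z -> y != z -> y' != z ->
  edot (y - z) (y' - z) <=
  enorm (y - z) * enorm (y' - z) * cos (angle x z y' - angle x z y).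
Proof.
rewrite -!(subr_eq0 _ z) /angle.
move: (x - z) (y - z) (y' - z) => e p q e0 p0 q0.
have a0 := enorm_gt0 e0; have b0 := enorm_gt0 p0; have c0 := enorm_gt0 q0.
rewrite cosB !acosK ?in_itv/= ?cosine_bounds // !sin_acos ?cosine_bounds //.
(* The product of the two sines in the expansion of the cosine is the product of
   the norms of the components orthogonal to e, up to the factor |p| |q|. *)
pose perp v := v - (edot e v / enorm e ^+ 2) *: e.
have perpE v w : edot (perp v) (perp w) =
    edot v w - edot e v * edot e w / enorm e ^+ 2.
  rewrite /perp !edotE (edotC v e) -!sqr_enorm; field; exact: lt0r_neq0.
have norm_perp v : v != 0 -> enorm (perp v) =
    enorm v * Num.sqrt (1 - (edot e v / (enorm e * enorm v)) ^+ 2).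
  move=> v0; have d0 := enorm_gt0 v0.
  rewrite -[X in X * _]ger0_norm ?enorm_ge0 // -sqrtr_sqr -sqrtrM ?sqr_ge0 //.
  congr Num.sqrt; rewrite perpE -sqr_enorm; field.
  by rewrite !lt0r_neq0.
have := edot_le_enorm (perp p) (perp q); rewrite perpE !norm_perp //.
rewrite lerBlDr => /le_trans; apply; rewrite le_eqVlt; apply/orP; left; apply/eqP.
by field; rewrite !lt0r_neq0.
Qed.

(** The law of cosines in the plane of the rotated configuration, in half-angle
    form, without the square of the difference of the two distances to z. *)
Lemma sqr_sin_half_angleB x z y y' : x != z -> y != z -> y' != z ->
  4 * enorm (y - z) * enorm (y' - z) *
    sin ((angle x z y' - angle x z y) / 2) ^+ 2 <= enorm (y - y') ^+ 2.
Proof.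
move=> xz yz yz'; have := edot_le_cos_angleB xz yz yz'.
set D := angle _ _ _ - _.
have -> : cos D = 1 - 2 * sin (D / 2) ^+ 2.
  by rewrite {1}[D]splitr -mulr2n cos_mulr2n sin2cos2; ring.
have -> : y - y' = (y - z) - (y' - z) by rewrite opprB addrA subrK.
move: (y - z) (y' - z) => p q.
rewrite [X in _ -> _ <= X]sqr_enorm !edotE -!sqr_enorm (edotC q p).
have := sqr_ge0 (enorm p - enorm q); lra.
Qed.

End Angle.

(** The mean value theorem gives sin t = t cos s for some s < t, and the cosine
    decreases.  This turns a bound on a small sine into one on the angle. *)
Lemma mul_cos_le_sin {R : realType} (t : R) :
  0 <= t <= pi / 2 -> t * cos t <= sin t.
Proof.
move=> /andP[]; rewrite le_eqVlt => /predU1P[<-|t0 tpi].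
  by rewrite mul0r sin0.
have [|c] := @MVT R sin cos 0 t t0.
  by apply: continuous_subspaceT; exact: continuous_sin.
rewrite in_itv/= sin0 !subr0 => /andP[c0 ct] ->.
rewrite mulrC ler_pM2r // ltW // ltr_cos // in_itv/=.
  by rewrite ltW //=; have := pi_gt0 R; lra.
by rewrite ltW //=; have := pi_gt0 R; lra.
Qed.

(** One step seen from z: [delta] bounds its length and [(1 - eta) * r] is a lower
    bound for the distance to z at its two ends.  The sine of half the angle is at
    most [delta / (2 (1 - eta) r)], hence at most [eta], so the cosine is at least
    [1 - eta]; replacing the sine by the angle costs the second factor
    [1 - eta]. *)
Lemma angleB_le_edist {R : realType} {n : nat} (x y y' z : 'rV[R]_n)
    (eta r delta : R) : x != z -> y != z -> y' != z ->
  0 < eta <= 2^-1 -> 0 < r -> delta <= eta * r ->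
  (1 - eta) * r <= enorm (y - z) -> (1 - eta) * r <= enorm (y' - z) ->
  enorm (y - y') <= delta ->
  (1 - eta) ^+ 2 * (angle x z y' - angle x z y) <= delta / r.
Proof.
move=> xz yz yz' /andP[eta0 eta12] r0 dr py py' yy'.
have delta0 : 0 <= delta by rewrite (le_trans _ yy') ?enorm_ge0.
have := sqr_sin_half_angleB xz yz yz'.
have : angle x z y' - angle x z y <= pi.
  by rewrite lerBlDr ler_wpDr ?angle_ge0 // angle_le_pi.
move: (angle x z y' - angle x z y) => D Dpi.
have [D0 _|D0] := leP D 0.
  apply: (@le_trans _ _ 0); last by rewrite divr_ge0 // ltW.
  by rewrite mulr_ge0_le0 // sqr_ge0.
have D2 : 0 <= D / 2 <= pi / 2 by lra.
have := mul_cos_le_sin D2.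
have s0 : 0 <= sin (D / 2) by apply: sin_ge0_pi; have := pi_gt0 R; lra.
have c0 : 0 <= cos (D / 2) by apply: cos_ge0_pihalf; have := pi_gt0 R; lra.
have := cos2Dsin2 (D / 2); move: (sin _) (cos _) s0 c0 => s c s0 c0 cs tc h.
have m0 : 0 < (1 - eta) * r by rewrite mulr_gt0 //; lra.
have hs : 2 * ((1 - eta) * r) * s <= delta.
  rewrite -(@ler_pXn2r _ 2%N) ?nnegrE //; last by rewrite mulr_ge0 //; lra.
  apply: le_trans (_ : _ <= enorm (y - y') ^+ 2) _; last first.
    by rewrite ler_pXn2r ?nnegrE ?enorm_ge0.
  apply: le_trans h; rewrite !exprMn -exprMn ler_wpM2r ?sqr_ge0 //.
  have := ler_pM (ltW m0) (ltW m0) py py'; lra.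
have hs' : 2 * (1 - eta) * s <= delta / r.
  by rewrite ler_pdivlMr //; lra.
have dr' : delta / r <= eta by rewrite ler_pdivrMr.
have se : s <= eta by nra.
have ce : 1 - eta <= c.
  have : s ^+ 2 <= eta by nra.
  have : c <= 1 by nra.
  nra.
have Ds : (1 - eta) * D <= 2 * s by have := ler_wpM2l (ltW D0) ce; lra.
apply: le_trans hs'; rewrite expr2 -mulrA [2 * _]mulrC -[leRHS]mulrA.
by rewrite ler_wpM2l //; lra.
Qed.

(** * Parametrization by arc length *)

Section CurveLength.
Context {R : realType} {n : nat}.
Implicit Types (a b s t : R) (g : R -> 'rV[R]_n).

(** In [polygon_length] the right end of the interval only serves as the default
    value of [nth], so it may change when a node is appended. *)
Lemma polygon_length_rcons a s t g p : last a p = s ->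
  polygon_length a t g (rcons p t) =
  polygon_length a s g p + enorm (g t - g s).
Proof.
move=> ps; rewrite /polygon_length size_rcons big_nat_recr //=.
congr (_ + enorm (g _ - g _)).
- apply: eq_big_nat => i /andP[_ ip].
  rewrite nth_rcons ip -rcons_cons nth_rcons /= (leqW ip).
  by congr (enorm (g _ - g _)); apply: set_nth_default => //=; exact: leqW.
- by rewrite nth_rcons ltnn eqxx.
- by rewrite -rcons_cons nth_rcons /= ltnSn -ps (last_nth t).
Qed.

Lemma curve_length_superadditive a s t g : s <= t ->
  (curve_length a s g + (enorm (g t - g s))%:E <= curve_length a t g)%E.
Proof.
rewrite le_eqVlt => /predU1P[->|st]; first by rewrite subrr enorm0 adde0.
rewrite -leeBrDr //; apply: ge_ereal_sup => _ [p [ap /eqP ps] <-].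
rewrite leeBrDr // -EFinD -(polygon_length_rcons t g ps).
apply: ereal_sup_ubound; exists (rcons p t) => //; split.
  by rewrite rcons_path ap ps.
by rewrite last_rcons.
Qed.

Lemma curve_length_ge0 a t g : a <= t -> (0 <= curve_length a t g)%E.
Proof.
move=> /(curve_length_superadditive a g); apply: le_trans.
rewrite adde_ge0 ?lee_fin ?enorm_ge0 //.
apply: le_trans (_ : ((polygon_length a a g [::])%:E <= _)%E).
  by rewrite lee_fin /polygon_length big_geq.
by apply: ereal_sup_ubound; exists [::].
Qed.

End CurveLength.

(** The length is at least u just after [tau u] and less than v just before
    [tau v]; superadditivity bounds distances between such nearby parameters, and
    the continuity of g carries the bounds over to [tau u] and [tau v]. *)
Section ArcLengthParam.
Context {R : realType} {n : nat}.
Variables (a b : R) (g : R -> 'rV[R]_n).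
Hypotheses (ab : a <= b) (cg : {within `[a, b], continuous g})
  (rect : (curve_length a b g < +oo)%E).

Let len t : R := fine (curve_length a t g).
Let L := len b.
Let reached u : set R := [set t | t \in `[a, b] /\ (u%:E <= curve_length a t g)%E].
Let tau u : R := inf (reached u).

Let lenE t : a <= t <= b -> curve_length a t g = (len t)%:E.
Proof.
move=> /andP[at_ tb]; rewrite fineK // ge0_fin_numE ?curve_length_ge0 //.
apply: le_lt_trans rect; apply: le_trans (curve_length_superadditive a g tb).
by rewrite leeDl // lee_fin enorm_ge0.
Qed.

Let lenD s t : a <= s -> s <= t -> t <= b -> len s + enorm (g t - g s) <= len t.
Proof.
move=> as_ st tb; rewrite -lee_fin EFinD -!lenE ?curve_length_superadditive //.
  by rewrite tb (le_trans as_).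
by rewrite as_ (le_trans st).
Qed.

Let reachedE u t : reached u t <-> a <= t <= b /\ u <= len t.
Proof.
rewrite /reached /= in_itv/=; split=> [] [atb]; rewrite lenE ?lee_fin //.
Qed.

Let reached_b u : u <= L -> reached u b.
Proof. by move=> uL; apply/reachedE; rewrite ab lexx. Qed.

Let lb_reached u : lbound (reached u) a.
Proof. by move=> t /reachedE[/andP[]]. Qed.

Let tau_ge u : u <= L -> a <= tau u.
Proof.
by move=> uL; apply: lb_le_inf => //; exists b; exact: reached_b.
Qed.

Let tau_le u : u <= L -> tau u <= b.
Proof. by move=> uL; apply: ge_inf; [exists a | exact: reached_b]. Qed.

Let len_lt_tau u t : a <= t -> t < tau u -> u <= L -> len t < u.
Proof.
move=> at_ ttau uL; rewrite ltNge; apply/negP => ut.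
suff : tau u <= t by rewrite leNgt ttau.
apply: ge_inf; first by exists a.
by apply/reachedE; rewrite at_ (le_trans (ltW ttau)) ?tau_le.
Qed.

Let len_gt_tau u t : u <= L -> tau u < t -> t <= b -> u <= len t.
Proof.
move=> uL taut tb.
have [|s /reachedE[/andP[as_ sb] us] st] := @inf_lt R (reached u) t _ taut.
  by exists b; exact: reached_b.
have := lenD as_ (ltW st) tb; have := enorm_ge0 (g t - g s); lra.
Qed.

Let continuous_enorm s (eps : R) : a <= s <= b -> 0 < eps ->
  exists2 d : R, 0 < d &
    forall r, a <= r <= b -> `|s - r| < d -> enorm (g r - g s) <= eps.
Proof.
move=> asb eps0.
have eps1 : 0 < eps / n.+1%:R by rewrite divr_gt0.
have /subspace_continuousP/(_ s) := cg.
rewrite /= in_itv/= asb => /(_ isT)/cvgrPdist_lt/(_ _ eps1).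
rewrite near_withinE => /nbhs_ballP[d /= d0 sd].
exists d => // r arb srd; rewrite enormB.
apply: le_trans (enorm_le_mx_norm _) _.
have /ltW := sd r srd arb; rewrite ler_pdivlMr //; apply: le_trans.
by rewrite mulrC ler_wpM2l // ler_nat.
Qed.

Let near_right s t (eps : R) : a <= s -> s < t -> t <= b -> 0 < eps ->
  exists2 r, s < r < t & enorm (g r - g s) <= eps.
Proof.
move=> as_ st tb eps0.
have [|d d0 sd] := @continuous_enorm s eps _ eps0.
  by rewrite as_ (le_trans (ltW st)).
have [h1 h2] : Num.min d (t - s) <= d /\ Num.min d (t - s) <= t - s.
  by split; rewrite ge_min lexx ?orbT.
have h0 : 0 < Num.min d (t - s) by rewrite lt_min d0 subr_gt0.
exists (s + Num.min d (t - s) / 2); first by apply/andP; split; lra.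
apply: sd; first by apply/andP; split; lra.
by rewrite opprD addNKr normrN gtr0_norm; lra.
Qed.

Let near_left s t (eps : R) : a <= s -> s < t -> t <= b -> 0 < eps ->
  exists2 r, s < r < t & enorm (g t - g r) <= eps.
Proof.
move=> as_ st tb eps0.
have [|d d0 td] := @continuous_enorm t eps _ eps0.
  by rewrite tb (le_trans as_) // ltW.
have [h1 h2] : Num.min d (t - s) <= d /\ Num.min d (t - s) <= t - s.
  by split; rewrite ge_min lexx ?orbT.
have h0 : 0 < Num.min d (t - s) by rewrite lt_min d0 subr_gt0.
exists (t - Num.min d (t - s) / 2); first by apply/andP; split; lra.
rewrite enormB; apply: td; first by apply/andP; split; lra.
by rewrite opprB addrC subrK gtr0_norm; lra.
Qed.

Lemma arc_length_param_lipschitz u v : u <= v -> v <= L ->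
  enorm (arc_length_param a b g v - arc_length_param a b g u) <= v - u.
Proof.
move=> uv vL; have uL := le_trans uv vL.
rewrite /arc_length_param -/(reached u) -/(reached v) -/(tau u) -/(tau v).
have [tt|tt|->] := ltgtP (tau u) (tau v); last 2 first.
- have m1 : tau v < (tau v + tau u) / 2 by lra.
  have m2 : (tau v + tau u) / 2 < tau u by lra.
  have := len_gt_tau vL m1 (le_trans (ltW m2) (tau_le uL)).
  have := len_lt_tau (le_trans (tau_ge vL) (ltW m1)) m2 uL; lra.
- by rewrite subrr enorm0 subr_ge0.
apply/ler_addgt0Pr => e e0.
have e2 : 0 < e / 2 by lra.
have au := tau_ge uL; have vb := tau_le vL.
(* s and t are chosen with tau u < s < t < tau v. *)
have [s /andP[us sv] gs] := near_right au tt vb e2.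
have [t /andP[st tv] gt] := near_left (le_trans au (ltW us)) sv vb e2.
have := lenD (le_trans au (ltW us)) (ltW st) (le_trans (ltW tv) vb).
have := len_gt_tau uL us (le_trans (ltW sv) vb).
have := len_lt_tau (le_trans au (ltW (lt_trans us st))) tv vL.
have := ler_edist_add (g s) (g (tau v)) (g (tau u)).
have := ler_edist_add (g t) (g (tau v)) (g s); lra.
Qed.

Lemma arc_length_param0 : arc_length_param a b g 0 = g a.
Proof.
have L0 : 0 <= L by rewrite fine_ge0 // curve_length_ge0.
suff tau0 : tau 0 = a by rewrite /arc_length_param -/(reached 0) -/(tau 0) tau0.
apply/eqP; rewrite eq_le (tau_ge L0) andbT.
apply: ge_inf; first by exists a.
by apply/reachedE; rewrite lexx ab fine_ge0 // curve_length_ge0.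
Qed.

(** The length L may be reached before the parameter b; the curve is then
    constant in between, since no length is left. *)
Lemma arc_length_paramL : arc_length_param a b g L = g b.
Proof.
have := tau_le (lexx L); rewrite le_eqVlt => /predU1P[|taub].
  by rewrite /arc_length_param -/(reached L) -/(tau L) => ->.
rewrite /arc_length_param -/(reached L) -/(tau L).
have aL := tau_ge (lexx L).
have : enorm (g b - g (tau L)) <= 0.
  apply/ler_addgt0Pr => e e0; rewrite add0r.
  have [s /andP[us sb] gs] := near_right aL taub (lexx b) e0.
  have := lenD (le_trans aL (ltW us)) (ltW sb) (lexx b).
  have := len_gt_tau (lexx L) us (ltW sb).
  have := ler_edist_add (g s) (g b) (g (tau L)).
  by rewrite -/L; lra.
apply: contraPP => gg; apply/negP; rewrite -ltNge enorm_gt0 // subr_eq0.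
by apply/eqP => h; exact: gg.
Qed.

Lemma arc_length_param_itv u : u <= L ->
  (g @` `[a, b]) (arc_length_param a b g u).
Proof.
by move=> uL; exists (tau u) => //=; rewrite in_itv/= tau_ge // tau_le.
Qed.

End ArcLengthParam.

(** * Distance to the boundary *)

Section BoundaryDist.
Context {R : realType} {n : nat}.
Variable G : set 'rV[R]_n.
Implicit Types (p q w : 'rV[R]_n).

Lemma boundary_dist_le p w : boundary G w -> boundary_dist G p <= enorm (p - w).
Proof.
move=> Gw; apply: ge_inf; last by exists w.
by exists 0 => _ [v _ <-]; exact: enorm_ge0.
Qed.

Lemma boundary_dist_lipschitz p q : boundary G !=set0 ->
  boundary_dist G p <= boundary_dist G q + enorm (p - q).
Proof.
move=> [w0 Gw0]; rewrite -lerBlDr.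
apply: lb_le_inf; first by exists (enorm (q - w0)), w0.
move=> _ [w Gw <-]; rewrite lerBlDr addrC.
exact: le_trans (boundary_dist_le p Gw) (ler_edist_add _ _ _).
Qed.

Lemma boundary_dist_ge0 p : 0 <= boundary_dist G p.
Proof.
rewrite /boundary_dist; have [->|/set0P Gn0] := eqVneq (boundary G) set0.
  by rewrite image_set0 inf0.
apply: lb_le_inf; first by case: Gn0 => w Gw; exists (enorm (p - w)), w.
by move=> _ [w _ <-]; exact: enorm_ge0.
Qed.

Hypothesis openG : open G.

Lemma boundary_disjoint w : boundary G w -> ~ G w.
Proof. by move=> [_]; rewrite (interior_id _).1. Qed.

Lemma boundary_dist_gt0 p : boundary G !=set0 -> G p -> 0 < boundary_dist G p.
Proof.
move=> [w0 Gw0] Gp.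
have /nbhs_ballP[e /= e0 eG] := open_nbhs_nbhs (conj openG Gp).
apply: lt_le_trans e0 _; apply: lb_le_inf; first by exists (enorm (p - w0)), w0.
move=> _ [w Gw <-]; rewrite leNgt; apply/negP => we.
apply: (boundary_disjoint Gw); apply: eG.
by rewrite -ball_normE /= (le_lt_trans _ we) // mx_norm_le_enorm.
Qed.

End BoundaryDist.

(** * Integration along the arc *)

Lemma lipschitz_within_continuous {R : realType} (f : R -> R) (a b : R) :
  (forall u v : R, a <= u -> u <= v -> v <= b -> `|f v - f u| <= v - u) ->
  {within `[a, b], continuous f}.
Proof.
move=> lf; apply/subspace_continuousP => u; rewrite /= in_itv/= => /andP[au ub].
apply/cvgrPdist_lt => e e0; rewrite near_withinE; apply/nbhs_ballP.
exists e => //= v uv; rewrite /= in_itv/= => /andP[av vb].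
apply: le_lt_trans uv; have [uv|/ltW vu] := leP u v.
  by rewrite distrC [leRHS]distrC (le_trans (lf _ _ au uv vb)) ?ler_norm.
by rewrite (le_trans (lf _ _ av vu ub)) ?ler_norm.
Qed.

(** Here c is a path of speed at most 1 that avoids z, and f a 1-Lipschitz positive
    lower bound for the distance to z along it, to be instantiated with the distance
    to the boundary. *)
Section AngleAlongPath.
Context {R : realType} {n : nat}.
Variables (c : R -> 'rV[R]_n) (z : 'rV[R]_n) (f : R -> R) (L : R).
Hypotheses (L0 : 0 <= L)
  (lip_c : forall u v : R, 0 <= u -> u <= v -> v <= L -> enorm (c v - c u) <= v - u)
  (lip_f : forall u v : R, 0 <= u -> u <= v -> v <= L -> `|f v - f u| <= v - u)
  (f_gt0 : forall u : R, 0 <= u <= L -> 0 < f u)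
  (f_le : forall u : R, 0 <= u <= L -> f u <= enorm (c u - z)).

Let theta u := angle (c 0) z (c u).
Let density u : \bar R := ((f u)^-1)%:E.
Let mu := @lebesgue_measure R.

Let c_neq (u : R) : 0 <= u <= L -> c u != z.
Proof.
move=> uL; apply: contraTneq (f_le uL) => ->.
by rewrite subrr enorm0 -ltNge f_gt0.
Qed.

Let measurable_density : measurable_fun `[0, L] density.
Proof.
apply/measurable_EFinP; apply: subspace_continuous_measurable_fun => //.
apply/subspace_continuousP => u uL; apply: cvgV.
  by rewrite gt_eqF // f_gt0 //; move: uL; rewrite /= in_itv.
by move/subspace_continuousP: (lipschitz_within_continuous lip_f); exact.
Qed.

(** On a step of length at most [eta * f u] the integrand is at least
    [1 / ((1 + eta) f u)], and [(1 - 3 eta) (1 + eta) <= (1 - eta)^2]. *)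
Let angle_step (eta u v : R) : 0 < eta <= 3^-1 -> 0 <= u -> u <= v -> v <= L ->
  v - u <= eta * f u ->
  (((1 - 3 * eta) * (theta v - theta u))%:E <=
    \int[mu]_(t in `]u, v]) density t)%E.
Proof.
move=> /andP[eta0 eta3] u0 uv vL vu.
have uL : 0 <= u <= L by rewrite u0 (le_trans uv).
have vL' : 0 <= v <= L by rewrite vL (le_trans u0).
have OL : 0 <= (0 : R) <= L by apply/andP.
have fu := f_gt0 uL.
have lipuv := lip_f u0 uv vL.
have := @angleB_le_edist R n (c 0) (c u) (c v) z eta (f u) (v - u).
rewrite -/(theta u) -/(theta v) !c_neq // => /(_ isT isT isT) h.
have : (1 - eta) ^+ 2 * (theta v - theta u) <= (v - u) / f u.
  apply: h => //.
  - by rewrite eta0 /=; lra.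
  - by apply: le_trans (f_le uL); nra.
  - by apply: le_trans (f_le vL'); move: lipuv; rewrite ler_norml; lra.
  - by rewrite enormB; exact: lip_c.
move: (theta v - theta u) => D hD.
apply: (@le_trans _ _ (((1 + eta) * f u)^-1%:E * (v - u)%:E)%E).
  have -> : (((1 + eta) * f u)^-1%:E * (v - u)%:E)%E =
      ((v - u) / f u / (1 + eta))%:E.
    by rewrite -EFinM; congr EFin; field; rewrite !lt0r_neq0 //; lra.
  rewrite lee_fin ler_pdivlMr; last lra.
  have [D0|D0] := leP D 0.
    apply: (@le_trans _ _ 0); last by rewrite divr_ge0 ?subr_ge0 // ltW.
    by rewrite mulr_le0_ge0 ?mulr_ge0_le0 //; lra.
  apply: le_trans hD; rewrite mulrAC ler_wpM2r ?ltW //; nra.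
have -> : (v - u)%:E = mu `]u, v].
  rewrite /mu lebesgue_measure_itv /= lte_fin.
  by move: uv; rewrite le_eqVlt => /predU1P[->|->]; rewrite ?ltxx ?subrr.
rewrite -integral_cst //; apply: ge0_le_integral => //.
- by move=> t _; rewrite lee_fin invr_ge0 mulr_ge0 //; lra.
- apply: measurable_funS measurable_density => // t /=.
  by rewrite !in_itv/= => /andP[ut tv]; rewrite (le_trans u0 (ltW ut)) (le_trans tv).
- move=> t; rewrite /= in_itv/= => /andP[/ltW ut tv].
  have tL : 0 <= t <= L by rewrite (le_trans u0 ut) (le_trans tv).
  rewrite lee_fin lef_pV2 ?posrE ?mulr_gt0 ?f_gt0 //; last lra.
  by have := lip_f u0 ut (le_trans tv vL); rewrite ler_norml; lra.
Qed.

(** The factor [r] < 1 absorbs the error of the subdivision. *)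
Lemma angle_le_integral :
  ((angle (c 0) z (c L))%:E <= \int[mu]_(u in `[0%R, L]) density u)%E.
Proof.
have O0L : 0 <= (0 : R) <= L by apply/andP.
have L0L : 0 <= L <= L by apply/andP.
have density_ge0 (u : R) : 0 <= u <= L -> (0 <= density u)%E.
  by move=> uL; rewrite lee_fin invr_ge0 ltW // f_gt0.
apply/lee_mul01Pr; first by rewrite lee_fin angle_ge0 // c_neq.
move=> r /andP[r0 r1]; rewrite -EFinM -/(theta L).
(* The value of eta for which [angle_step] loses exactly the factor r. *)
pose eta := (1 - r) / 3.
have eta0 : 0 < eta <= 3^-1 by rewrite /eta; apply/andP; split; lra.
have -> : r = 1 - 3 * eta by rewrite /eta; field.
have [m] := EVT_min L0 (lipschitz_within_continuous lip_f).
rewrite in_itv/= => mL fm.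
have fm0 : 0 < eta * f m by rewrite mulr_gt0 ?f_gt0 //; case/andP: eta0.
(* Enough steps to make each one shorter than eta times the minimum of f. *)
pose N := (Num.truncn (L / (eta * f m))).+1.
have N0 : (0 : R) < N%:R by rewrite ltr0n.
have LN : L / N%:R <= eta * f m.
  by rewrite ler_pdivrMr // mulrC -ler_pdivrMr // ltW // truncnS_gt.
pose t k := k%:R * (L / N%:R).
have tN : t N = L by rewrite /t mulrC divfK // gt_eqF.
have d0 : 0 <= L / N%:R by rewrite divr_ge0 // ltW.
have t0 k : 0 <= t k by rewrite mulr_ge0.
have t_le k l : (k <= l)%N -> t k <= t l by move=> kl; rewrite ler_wpM2r ?ler_nat.
have tS k : t k.+1 - t k = L / N%:R.
  by rewrite /t -mulrBl -natrB ?leqnSn // subSnn mul1r.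
suff main k : (k <= N)%N ->
    (((1 - 3 * eta) * theta (t k))%:E <= \int[mu]_(u in `[0%R, t k]) density u)%E.
  by have := main N (leqnn N); rewrite tN.
elim: k => [_|k IH kN].
  rewrite /t mul0r /theta angle_xzx ?c_neq // mulr0 integral_ge0 // => u.
  rewrite /= in_itv/= => /andP[u0 u1].
  by apply: density_ge0; rewrite u0 (le_trans u1).
have tkL : t k.+1 <= L by rewrite -tN t_le.
have tk1 : t k <= t k.+1 by rewrite t_le.
have sub : `[0, t k.+1] `<=` `[0, L].
  by move=> u; rewrite /= !in_itv/= => /andP[-> /le_trans]; exact.
have splitI : [set` `[0, t k.+1]] = `[0, t k] `|` `]t k, t k.+1].
  by apply: itv_bndbnd_setU; rewrite bnd_simp.
rewrite splitI ge0_integral_setU //; first last.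
- apply/disj_setPS => u [] /=; rewrite !in_itv/= => /andP[_ ut] /andP[tu _].
  by move: (lt_le_trans tu ut); rewrite ltxx.
- by rewrite -splitI => u /sub; rewrite /= in_itv; exact: density_ge0.
- by rewrite -splitI; apply: measurable_funS measurable_density.
rewrite -[theta (t k.+1)](subrK (theta (t k))) mulrDr EFinD addeC.
apply: leeD; first exact: IH (ltnW kN).
apply: angle_step => //.
rewrite tS (le_trans LN) // ler_pM2l ?fm //; last by case/andP: eta0.
by rewrite in_itv/= t0 (le_trans tk1).
Qed.

End AngleAlongPath.

(** * Comparison of the two metrics *)

Lemma visual_angle_le_quasihyperbolic {R : realType} {n : nat}
    (G : set 'rV[R]_n) (x y : 'rV[R]_n) : open G ->
  (visual_angle G x y <= quasihyperbolic G x y)%E.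
Proof.
move=> openG; apply: ge_ereal_sup => _ [z Gz <-].
apply: le_ereal_inf_tmp => _ [a [b [g [[ab cg _ rect [<- <- gG]] ->]]]].
have Gz0 : boundary G !=set0 by exists z.
rewrite -(arc_length_param0 ab rect) -(arc_length_paramL ab cg rect).
set L := fine _; have L0 : 0 <= L by rewrite fine_ge0 // curve_length_ge0.
set c := arc_length_param a b g.
have lip_c (u v : R) : 0 <= u -> u <= v -> v <= L -> enorm (c v - c u) <= v - u.
  by move=> _; exact: arc_length_param_lipschitz.
apply: (@angle_le_integral R n c z (boundary_dist G \o c)) => //=.
- move=> u v u0 uv vL; rewrite ler_norml.
  have := lip_c _ _ u0 uv vL.
  have := boundary_dist_lipschitz (c u) (c v) Gz0; rewrite enormB.
  have := boundary_dist_lipschitz (c v) (c u) Gz0; lra.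
- move=> u /andP[_ uL]; apply: boundary_dist_gt0 => //.
  by apply: gG; exact: arc_length_param_itv.
- by move=> u _; exact: boundary_dist_le.
Qed.

(** Both bounds are crude: [2 <= pi] and [ln 2 <= 1]. *)
Lemma pi_div_ln4_ge1 {R : realType} : 1 <= pi / ln (4 : R).
Proof.
have -> : ln (4 : R) = 2 * ln 2.
  by rewrite mulr_natl -lnXn //; congr ln; ring.
have l0 : 0 < ln (2 : R) by rewrite ln_gt0 // ltr1n.
rewrite ler_pdivlMr ?mulr_gt0 // mul1r (le_trans _ (pi_ge2 R)) // ler_piMr //.
by have := @le_ln1Dx R 1; rewrite -[1 + 1]/(2 : R); apply; lra.
Qed.

Theorem theorem4p4 (R : realType) (n : nat) (n_ge2 : (2 <= n)%N)
    (G : set 'rV[R]_n) (domG : is_domain G) (properG : G <> setT)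
    (convexG : @convex_set R 'rV[R]_n G) (x y : 'rV[R]_n) (Gx : G x) (Gy : G y) :
  (visual_angle G x y <= (pi / ln 4)%:E * quasihyperbolic G x y)%E.
Proof.
case: domG => openG _ _.
apply: le_trans (visual_angle_le_quasihyperbolic x y openG) _.
have k0 : (0 <= quasihyperbolic G x y)%E.
  apply: le_ereal_inf_tmp => _ [a [b [g [_ ->]]]].
  apply: integral_ge0 => u _; rewrite lee_fin invr_ge0.
  exact: boundary_dist_ge0.
by rewrite lee_pemull // lee_fin pi_div_ln4_ge1.
Qed.
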